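(* Let $\Delta$ be an essential toric arrangement in normal form with respect to a basis $\mathcal{B}$ and a maximal forest $\mathcal{A}$. Then the linear relations with integer coefficients among the characters of $\Delta$ are uniquely determined by the poset of layers $\mathscr{S}$. That is: if $\Delta=\{(a_e,\chi_e)\}_{e\in E}$ and $\Delta'=\{(a'_e,\chi'_e)\}_{e\in E}$ are essential toric arrangements indexed by the same finite set $E$, with the same poset of layers over $E$ and both in normal form with respect to the same $\mathcal{B}$ and $\mathcal{A}$, then for all integers $(n_e)_{e\in E}$ one has $\sum_{e}n_e\chi_e=0$ if and only if $\sum_en_e\chi'_e=0$.
   Context: A toric arrangement in a torus $T\simeq(\mathbb{C}^* )^r$ with character group $\Lambda$ is a finite family $\Delta=\{(a_e,\chi_e)\}_{e\in E}$, $a_e\in\mathbb{C}^*$, $0\ne\chi_e\in\Lambda$, with hypertori $H_e=\{t\in T:a_e\chi_e(t)=1\}$. It is essential if the $\chi_e$ span $\Lambda\otimes\mathbb{Q}$. The poset of layers $\mathscr{S}$ is the set of connected components of nonempty intersections of hypertori ($T$ included) ordered by reverse inclusion, ranked by codimension. Two arrangements indexed by $E$ have the same poset of layers over $E$ if there is a poset isomorphism $\mathscr{S}\to\mathscr{S}'$ carrying, for each $e$, the set of connected components of $H_e$ onto that of $H'_e$. Normal form: let $\mathcal{B}\subseteq E$ be such that $(\chi_b)_{b\in\mathcal{B}}$ is a basis of $\Lambda\otimes\mathbb{Q}$ and write $\chi_e=\sum_{b\in\mathcal{B}}a_{b,e}\chi_b$ for $e\in E\setminus\mathcal{B}$, $a_{b,e}\in\mathbb{Q}$.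 Let $\mathcal{G}$ be the bipartite graph with vertex classes $\mathcal{B}$, $E\setminus\mathcal{B}$ and an edge joining $b$ and $e$ iff $a_{b,e}\ne0$, and let $\mathcal{A}$ be a maximal forest (maximal acyclic subgraph) of $\mathcal{G}$. $\Delta$ is in normal form with respect to $\mathcal{B},\mathcal{A}$ if $a_{b,e}>0$ for all edges of $\mathcal{A}$. (The graph $\mathcal{G}$ depends only on the poset of layers over $E$ and on $\mathcal{B}$.) *)

(* Defs.v *)
From HB Require Import structures.
From mathcomp Require Import all_boot all_order all_algebra.
From mathcomp Require Import all_classical all_reals all_analysis.
From mathcomp Require Import complex.
Export numFieldNormedType.Exports.

Set Implicit Arguments.
Unset Strict Implicit.
Unset Printing Implicit Defensive.

Import Order.TTheory GRing.Theory Num.Theory.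

Local Open Scope classical_set_scope.
Local Open Scope ring_scope.

(* The cast to [numFieldType] is what gives the complex numbers their norm
   topology, and ['rV[CC R]_r] the product topology. *)
Definition CC (R : realType) : numFieldType := R[i].

Section ToricArrangements.
Variable R : realType.

(* The torus is taken in coordinates: T = (C^* )^r inside C^r, with character
   group Z^r; m in Z^r is the Laurent monomial t |-> \prod_i t_i ^ m_i. *)
Definition torus (r : nat) : set 'rV[CC R]_r := [set t | forall i, t 0 i != 0].

Definition eval_char (r : nat) (m : 'rV[int]_r) (t : 'rV[CC R]_r) : CC R :=
  \prod_(i < r) t 0 i ^ m 0 i.

Record toric_arrangement (E : finType) (r : nat) := ToricArrangement {
  arr_const : E -> CC R;
  arr_char : E -> 'rV[int]_r;
  arr_const_neq0 : forall e, arr_const e != 0;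
  arr_char_neq0 : forall e, arr_char e != 0 }.

Definition hypertorus (E : finType) (r : nat) (D : toric_arrangement E r)
    (e : E) : set 'rV[CC R]_r :=
  [set t | torus t /\ arr_const D e * eval_char (arr_char D e) t = 1].

Definition components (T : topologicalType) (X : set T) : set (set T) :=
  connected_component X @` X.

(* The torus is intersected in explicitly, so that A = set0 gives T. *)
Definition hypertori_cap (E : finType) (r : nat) (D : toric_arrangement E r)
    (A : {set E}) : set 'rV[CC R]_r :=
  @torus r `&` \bigcap_(e in [set` A]) hypertorus D e.

(* An empty intersection has no component, so it contributes no layer. *)
Definition is_layer (E : finType) (r : nat) (D : toric_arrangement E r)
    (W : set 'rV[CC R]_r) : Prop :=
  exists A : {set E}, components (hypertori_cap D A) W.

Definition layer (E : finType) (r : nat) (D : toric_arrangement E r) : Type :=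
  {W : set 'rV[CC R]_r | is_layer D W}.

Definition layer_le (E : finType) (r : nat) (D : toric_arrangement E r)
    (V W : layer D) : Prop :=
  proj1_sig W `<=` proj1_sig V.

Definition hypertorus_layers (E : finType) (r : nat)
    (D : toric_arrangement E r) (e : E) : set (layer D) :=
  [set W | components (hypertorus D e) (proj1_sig W)].
Arguments hypertorus_layers {E r} D e.

Definition same_layer_poset (E : finType) (r r' : nat)
    (D : toric_arrangement E r) (D' : toric_arrangement E r') : Prop :=
  exists phi : layer D -> layer D',
    [/\ bijective phi,
        forall V W, layer_le V W <-> layer_le (phi V) (phi W) &
        forall e, phi @` hypertorus_layers D e = hypertorus_layers D' e].

Definition rat_char (E : finType) (r : nat) (D : toric_arrangement E r)
    (e : E) : 'rV[rat]_r :=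
  map_mx (fun z : int => z%:~R) (arr_char D e).

Definition essential (E : finType) (r : nat) (D : toric_arrangement E r) :
    Prop :=
  (<<[seq rat_char D e | e <- enum E]>> = fullv)%VS.

Definition char_basis (E : finType) (r : nat) (D : toric_arrangement E r)
    (B : {set E}) : Prop :=
  basis_of fullv [seq rat_char D b | b <- enum B].

(* When B is a basis this determines [a b e] for b in B and e outside B; the
   other values of [a] are irrelevant. *)
Definition basis_coeffs (E : finType) (r : nat) (D : toric_arrangement E r)
    (B : {set E}) (a : E -> E -> rat) : Prop :=
  forall e, e \notin B -> rat_char D e = \sum_(b in B) a b e *: rat_char D b.

(* The edge joining b in B and e outside B is encoded as the pair (b, e). *)
Definition bip_graph (E : finType) (B : {set E}) (a : E -> E -> rat) :
    {set E * E} :=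
  [set p : E * E | [&& p.1 \in B, p.2 \notin B & a p.1 p.2 != 0]]%SET.

Definition adjacent (E : finType) (A : {set E * E}) : rel E :=
  fun x y => ((x, y) \in A) || ((y, x) \in A).

(* A 2-element [ucycle] only runs back and forth along one edge. *)
Definition acyclic (E : finType) (A : {set E * E}) : Prop :=
  forall c : seq E, (2 < size c)%N -> ~ ucycle (adjacent A) c.

Definition maximal_forest (E : finType) (G A : {set E * E}) : Prop :=
  [/\ A \subset G, acyclic A &
      forall A' : {set E * E},
        A' \subset G -> acyclic A' -> A \subset A' -> A' = A].

Definition normal_form (E : finType) (r : nat) (D : toric_arrangement E r)
    (B : {set E}) (A : {set E * E}) : Prop :=
  char_basis D B /\
  exists a : E -> E -> rat,
    [/\ basis_coeffs D B a, maximal_forest (bip_graph B a) A &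
        forall b e, (b, e) \in A -> 0 < a b e].

End ToricArrangements.

(* Main.v *)
Require Import Defs.
From mathcomp Require Import all_boot all_order all_algebra.
From mathcomp Require Import all_classical all_reals all_analysis.
From mathcomp Require Import zify lra.
From mathcomp Require Import perm separable complex.
Import Order.TTheory GRing.Theory Num.Theory.
Local Open Scope ring_scope.

Set Implicit Arguments.
Unset Strict Implicit.
Unset Printing Implicit Defensive.

(* For r characters chi_(f i) with matrix M, the hypertori H_(f i) meet in
   |det M| points when det M <> 0 (Smith normal form), so |det M| is the number
   of layers contained in all of them. When det M = 0 the intersection is empty or
   contains a translate of a one-parameter subgroup, hence two comparable
   layers, by essentiality; this tells the two cases apart, and so the poset
   determines |det M| for every f. By Cramer's rule it determines the absolute
   values of all minors of the matrix (a_{b,e}), in particular of its entries.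
   The signs follow from the normal form: if some sign differed, take such an
   edge and a walk of agreeing edges joining its ends (one exists inside the
   maximal forest), with the walk as short as possible. Together they form a
   chordless cycle, whose minor is a sum of two nonzero monomials P + Q for one
   arrangement and P - Q for the other, and these have different absolute
   values. Finally, the coordinates of the characters in a common basis
   determine their linear relations. *)

(** * Shortest walks *)

Section ShortestWalk.
Variables (T : Type) (S Q : T -> T -> Prop).

Definition walk (n : nat) (x : nat -> T) : Prop :=
  forall i, (i < n)%N -> S (x i) (x i.+1).

Lemma subwalk n x i j : (i <= j <= n)%N -> walk n x ->
  walk (j - i) (fun k => x (i + k)%N).
Proof. by move=> ij wx k kij; rewrite addnS; apply: wx; lia. Qed.

Lemma rev_walk n x : (forall u v, S u v -> S v u) -> walk n x ->
  walk n (fun k => x (n - k)%N).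
Proof.
move=> Ssym wx k kn; apply: Ssym.
have -> : (n - k = (n - k.+1).+1)%N by lia.
by apply: wx; lia.
Qed.

(** The stretch between positions [i] and [j] is replaced by [d] steps: by none when the two
    vertices coincide, by a single one when they are related. *)
Lemma shortcut_walk n x i j d : (i < j <= n)%N -> walk n x ->
  (i + d <= j)%N -> (d <= 1)%N ->
  (d = 0%N -> x i = x j) -> (d = 1%N -> S (x i) (x j)) ->
  walk (n - (j - i) + d)
    (fun k => if (k <= i)%N then x k else x (k + (j - i) - d)%N).
Proof.
move=> ij wx dij d1 h0 h1 k kn; case: (ltngtP k i) => ki.
- by apply: wx; lia.
- have -> : (k.+1 + (j - i) - d = (k + (j - i) - d).+1)%N by lia.
  by apply: wx; lia.
- case: d d1 dij h0 h1 kn => [|[|d]] // d1 dij h0 h1 kn.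
    rewrite ki h0 //; have -> : (i.+1 + (j - i) - 0 = j.+1)%N by lia.
    by apply: wx; lia.
  by rewrite ki (_ : i.+1 + (j - i) - 1 = j)%N; [exact: h1 | lia].
Qed.

(** Take the length minimal. A repeated vertex or a chord would give a shorter walk with the same
    ends, and a [Q]-related pair in the interior would give a shorter subwalk, reversed if need
    be. *)
Lemma shortest_walk : (forall u v, S u v -> S v u) ->
  (exists n x, walk n x /\ Q (x 0%N) (x n)) ->
  exists n x, [/\ walk n x, Q (x 0%N) (x n),
    forall i j, (i < j <= n)%N -> x i <> x j,
    forall i j, (i < j <= n)%N -> S (x i) (x j) ->
      j = i.+1 \/ (i = 0%N /\ j = n) &
    forall i j, (i <= n)%N -> (j <= n)%N -> Q (x i) (x j) -> i <> j ->
      (i = 0%N /\ j = n) \/ (i = n /\ j = 0%N)].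
Proof.
move=> Ssym; pose P n := `[< exists x, walk n x /\ Q (x 0%N) (x n) >].
move=> [m0 [x0 Hx0]]; have exP : exists n, P n.
  by exists m0; apply/asboolP; exists x0.
case: (ex_minnP exP) => n /asboolP[x [wx Qx]] nmin; exists n, x.
have {}nmin m y : walk m y -> Q (y 0%N) (y m) -> (n <= m)%N.
  by move=> wy Qy; apply: nmin; apply/asboolP; exists y.
split=> //.
- move=> i j ij xij.
  suff: (n <= n - (j - i) + 0)%N by lia.
  apply: (nmin _ _ (@shortcut_walk n x i j 0 ij wx _ _ _ _)) => //; first by lia.
  case: ifP => h; last by have -> : (n - (j - i) + 0 + (j - i) - 0 = n)%N by lia.
  have [-> jn] : (n - (j - i) + 0)%N = i /\ j = n by lia.
  by rewrite xij jn.
- move=> i j ij Sij; case: (eqVneq j i.+1) => [|ji]; first by left.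
  right; suff: (n <= n - (j - i) + 1)%N by lia.
  apply: (nmin _ _ (@shortcut_walk n x i j 1 ij wx _ _ _ _)) => //; first by lia.
  case: ifP => h; first by lia.
  by have -> : (n - (j - i) + 1 + (j - i) - 1 = n)%N by lia.
- move=> i j iN jN Qij ij; have [lt_ij|le_ji] := ltnP i j.
    have := @subwalk n x i j ltac:(lia) wx => /nmin.
    rewrite addn0 (_ : i + (j - i) = j)%N; last by lia.
    by move=> /(_ Qij); lia.
  have := @subwalk n x j i ltac:(lia) wx => /(rev_walk Ssym) /nmin.
  rewrite subn0 subnn addn0 (_ : j + (i - j) = i)%N; last by lia.
  by move=> /(_ Qij); lia.
Qed.

End ShortestWalk.

(** * Signs along chordless cycles *)

(** Rows outside [p] are unit vectors, so only permutations fixing every index outside [p]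
    contribute. Such permutations preserve [p], and the entries replaced by 0 never occur in their
    products. *)
Lemma det_zero_columns (F : comNzRingType) (r : nat)
  (p : pred 'I_r) (M : 'M[F]_r) :
  (forall i j, ~~ p i -> M i j = (i == j)%:R) ->
  \det M = \det (\matrix_(i, j) if p i ==> p j then M i j else 0).
Proof.
move=> Mp; rewrite /determinant; apply: eq_bigr => s _; congr (_ * _).
have [sp|] := pselect (forall i, ~~ p i -> s i = i).
  apply: eq_bigr => i _; rewrite mxE; case: ifP => // /negbT.
  rewrite negb_imply => /andP[pi npsi].
  by move: (npsi); rewrite (perm_inj (sp _ npsi)) pi.
move=> /existsNP[i /not_implyP[pi /eqP si]].
rewrite (bigD1 i) //= [in RHS](bigD1 i) //= mxE (negPf pi) /= Mp //.
by rewrite eq_sym (negPf si) !mul0r.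
Qed.

Lemma ker0_det (F : fieldType) (r : nat) (M : 'M[F]_r) :
  (forall v : 'I_r -> F, (forall i, \sum_j M i j * v j = 0) -> forall j, v j = 0) ->
  \det M != 0.
Proof.
move=> kM; apply/negP; rewrite -det_tr => /det0P[v vn0 vM].
case/negP: vn0; apply/eqP/rowP => j; rewrite mxE.
apply: (kM (fun j => v 0 j)) => i.
have /rowP/(_ i) := vM; rewrite !mxE => vMi; rewrite -[RHS]vMi.
by apply: eq_bigr => l _; rewrite mxE mulrC.
Qed.

Lemma delta_rV (R : pzSemiRingType) n (i l : 'I_n) :
  (delta_mx 0 i : 'rV[R]_n) 0 l = (l == i)%:R.
Proof. by rewrite mxE. Qed.

Section CycleSigns.
Variables (F : realFieldType) (E : finType) (r : nat) (g : 'I_r -> E).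
Variables (X X' : E -> 'rV[F]_r).
Hypothesis g_inj : injective g.
Hypothesis Xg : forall j, X (g j) = delta_mx 0 j.
Hypothesis X'g : forall j, X' (g j) = delta_mx 0 j.
Hypothesis eq_normdet : forall f : 'I_r -> E,
  `|\det (\matrix_i X (f i))| = `|\det (\matrix_i X' (f i))|.

(** Every coordinate is itself a minor, so the hypothesis on determinants fixes its absolute
    value. *)
Lemma det_replace_row (Y : E -> 'rV[F]_r) v (j : 'I_r) :
  (forall i, Y (g i) = delta_mx 0 i) ->
  \det (\matrix_i Y (if i == j then v else g i)) = Y v 0 j.
Proof.
move=> Yg; rewrite (@det_zero_columns _ _ (pred1 j)); last first.
  by move=> i l /= /negPf ij; rewrite mxE ij Yg delta_rV eq_sym.
set M := (X in \det X).
have -> : M = diag_mx (\row_i if i == j then Y v 0 j else 1).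
  apply/matrixP => i l; rewrite !mxE /=; have [->|nij] := eqVneq i j.
    by have [->|] := eqVneq l j.
  by rewrite /= Yg delta_rV; case: (eqVneq l i).
rewrite det_diag (bigD1 j) //= big1 ?mulr1 ?mxE ?eqxx // => i /negPf ij.
by rewrite mxE ij.
Qed.

Lemma eq_norm_entry v j : `|X v 0 j| = `|X' v 0 j|.
Proof. by rewrite -(det_replace_row v j Xg) -(det_replace_row v j X'g). Qed.

(** These are the edges of the bipartite graph, written with the basis element [u] first, whose
    coefficient is the same in [X] and [X']. *)
Definition agree (u v : E) : Prop := exists j,
  [/\ u = g j, v \notin codom g, X v 0 j != 0 & X v 0 j = X' v 0 j].

Definition agree_sym (u v : E) : Prop := agree u v \/ agree v u.

Definition differ (u v : E) : Prop := exists j,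
  u = g j /\ X v 0 j != X' v 0 j.

Lemma differ_notin u v : differ u v -> v \notin codom g.
Proof. by move=> [j [_]]; apply: contraNN => /codomP[l ->]; rewrite Xg X'g. Qed.

Lemma agree_sym_codom u v :
  agree_sym u v -> (v \in codom g) = ~~ (u \in codom g).
Proof.
by case=> -[j [-> /negPf -> _ _]]; rewrite ?codom_f.
Qed.

(** In a shortest counterexample, basis elements sit at even positions and the others at odd ones,
    and the closing pair [x 0], [x n] makes the walk a chordless cycle. Its minor is affine in the
    closing coefficient, which has opposite signs in [X] and [X']; equal absolute values would make
    one of the two terms vanish, but both are products of nonzero coefficients up to sign. *)
Lemma agree_walk_differ n x : walk agree_sym n x -> ~ differ (x 0%N) (x n).
Proof.
move=> wx0 dx0.
have Ssym u v : agree_sym u v -> agree_sym v u by case; [right | left].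
have [{wx0 dx0}] := @shortest_walk E agree_sym differ Ssym
  (ex_intro _ n (ex_intro _ x (conj wx0 dx0))).
move=> {}n [{}x [wx dx inj_x chord_agree chord_differ]].
have xi_inj i j : (i <= n)%N -> (j <= n)%N -> x i = x j -> i = j.
  move=> iN jN xij; case: (ltngtP i j) => // ij.
    by case: (inj_x i j) => //; lia.
  by case: (inj_x j i) => //; lia.
have [j0 [x0 xn]] := dx.
have xnB := differ_notin dx.
have par i : (i <= n)%N -> (x i \in codom g) = ~~ odd i.
  elim: i => [|i IH] iN; first by rewrite x0 codom_f.
  by rewrite (agree_sym_codom (wx i iN)) IH //; lia.
have oddn : odd n by move: xnB; rewrite par // negbK.
have diag k l : (k < n)%N -> x k = g l -> X (x k.+1) 0 l != 0.
  move=> kn xk; case: (wx k kn) => -[l' [e vB X0 _]].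
    by move: e; rewrite xk => /g_inj ->.
  by rewrite xk codom_f in vB.
have codiag k l : (k < n)%N -> x k.+1 = g l -> X (x k) 0 l != 0.
  move=> kn xk; case: (wx k kn) => -[l' [e vB X0 _]].
    by rewrite xk codom_f in vB.
  by move: e; rewrite xk => /g_inj ->.
(* By minimality, no pair other than the closing one can differ. *)
have same k l i : (k <= n)%N -> (i <= n)%N -> odd i -> x k = g l ->
    ~ (k = 0 /\ i = n)%N -> X (x i) 0 l = X' (x i) 0 l.
  move=> kn iN oi xk ne; apply/eqP/negP => /negP nX.
  have ek : ~~ odd k by rewrite -par // xk codom_f.
  case: (chord_differ k i) => //; first by exists l.
    by move=> ki; move: ek; rewrite ki oi.
  by move=> [_ i0]; rewrite i0 in oi.
(* A nonzero coefficient that agrees is a step of the walk relation, so the absence of chords leaves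
   only neighbours on the walk and the closing pair. *)
have edge k l i : (k <= n)%N -> (i <= n)%N -> odd i -> x k = g l ->
    X (x i) 0 l != 0 -> [\/ k.+1 = i, k = i.+1 | (k = 0 /\ i = n)%N].
  move=> kn iN oi xk X0.
  have [h|ne] := pselect (k = 0 /\ i = n)%N; first by constructor 3.
  have ek : ~~ odd k by rewrite -par // xk codom_f.
  have eX := same k l i kn iN oi xk ne.
  have ag : agree (x k) (x i) by exists l; split=> //; rewrite par // oi.
  case: (ltngtP k i) => ki.
  - by case: (chord_agree k i) => //; [lia | left | move=> ->; constructor].
  - case: (chord_agree i k) => //; [lia | by right | by move=> ->; constructor 2|].
    by move=> [i0]; rewrite i0 in oi.
  - by move: ek; rewrite ki oi.
have n1 : (1 < n)%N.
  rewrite ltnNge; apply/negP => le1; have n1 : n = 1%N by lia.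
  rewrite n1 in xn wx; case: (wx 0%N isT) => -[l [e vB _ eX]].
    by move: e xn; rewrite x0 => /g_inj ->; rewrite eX eqxx.
  by rewrite x0 codom_f in vB.
(* [k j] is the position of [g j] on the walk, with [n.+1] as the value for basis elements off the
   walk. *)
have /choice[k kP] (j : 'I_r) : exists kj : nat,
    ((kj <= n)%N /\ x kj = g j) \/
    (kj = n.+1 /\ forall i, (i <= n)%N -> x i <> g j).
  have [[i [iN xi]]|h] := pselect (exists i, (i <= n)%N /\ x i = g j).
    by exists i; left.
  by exists n.+1; right; split=> // i iN xi; apply: h; exists i.
pose p : pred 'I_r := fun j => (k j <= n)%N.
have pk j : p j -> x (k j) = g j.
  by move=> pj; case: (kP j) => -[]//; rewrite /p in pj; lia.
have kx i j : (i <= n)%N -> x i = g j -> k j = i.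
  move=> iN xi; case: (kP j) => -[]; last by move=> _ /(_ i iN).
  by move=> kn xk; apply: xi_inj => //; rewrite xi.
have keven j : p j -> ~~ odd (k j).
  by move=> pj; rewrite -par // pk // codom_f.
have klt j : p j -> (k j < n)%N.
  move=> pj; have := keven j pj; rewrite ltn_neqAle [(k j <= n)%N]pj andbT.
  by apply: contraNneq => ->.
have kinj i j : p i -> p j -> k i = k j -> i = j.
  by move=> pi pj kij; apply: g_inj; rewrite -pk // kij pk.
have oex i : (i <= n)%N -> ~~ odd i -> exists2 j, p j & k j = i.
  move=> iN; rewrite -par // => /codomP[j xi]; exists j; rewrite ?/p (kx i) //.
have [j1 pj1 kj1] : exists2 j, p j & k j = n.-1.
  by apply: oex; [lia | move: oddn n1; case: (n) => //= m; rewrite negbK].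
have kj0 : k j0 = 0%N by apply: kx.
have pj0 : p j0 by rewrite /p kj0.
have j10 : j1 != j0 by apply/eqP => e; move: kj1; rewrite e kj0; lia.
(* Each basis element on the walk is replaced by its successor there; the rest stay and give unit
   rows. Row [j1] is then [x n], so the closing coefficient is the entry [(j1, j0)]. *)
pose f j := if p j then x (k j).+1 else g j.
pose z (Y : E -> 'rV[F]_r) : 'M[F]_r :=
  \matrix_(i, j) if p i ==> p j then (\matrix_i Y (f i)) i j else 0.
have detz Y : (forall j, Y (g j) = delta_mx 0 j) ->
    \det (\matrix_i Y (f i)) = \det (z Y).
  move=> Yg; apply: det_zero_columns => i j /negPf npi.
  by rewrite mxE /f npi Yg delta_rV eq_sym.
have zE Y i j : z Y i j = if p i ==> p j then Y (f i) 0 j else 0 by rewrite !mxE.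
(* [Z] is opaque so that [mxE] does not unfold it. *)
have [Z eZ] : exists Z, Z = z X by exists (z X).
have Zdelta i j : ~~ p i -> Z i j = (i == j)%:R.
  by move=> npi; rewrite eZ zE (negPf npi) /= /f (negPf npi) Xg delta_rV eq_sym.
have fE i : p i -> f i = x (k i).+1 by rewrite /f => ->.
have ok i : p i -> odd (k i).+1 by move=> /keven.
have Zedge i l : p i -> Z i l != 0 ->
    p l /\ [\/ l = i, k l = (k i).+2 | l = j0 /\ i = j1].
  move=> pi; rewrite eZ zE pi /=; case: ifP => pl; last by rewrite eqxx.
  rewrite fE // => /(edge _ _ _ pl (klt i pi) (ok i pi) (pk l pl)) h; split=> //.
  case: h => [[/kinj ->//]| ->|[kl ki]]; [by constructor|by constructor 2|].
  by constructor 3; split; apply: kinj => //; [rewrite kj0 | rewrite kj1 -ki].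
have zX' i l : (i, l) != (j1, j0) -> z X' i l = Z i l.
  move=> ne; rewrite eZ !zE; case: ifP => // pil.
  have [pi|npi] := boolP (p i); last by rewrite /f (negPf npi) Xg X'g.
  have pl : p l by move: pil; rewrite pi.
  rewrite fE //; apply/esym/(same (k l)); rewrite ?ok ?pk //; first exact: klt.
  move=> [kl ki]; move/eqP: ne; apply; congr pair; apply: kinj => //.
    by rewrite kj1 -ki.
  by rewrite kj0.
have fj1 : f j1 = x n by rewrite fE // kj1; congr x; lia.
have zj : z X' j1 j0 = - Z j1 j0.
  rewrite eZ !zE pj1 pj0 /= fj1.
  have /eqP := eq_norm_entry (x n) j0; rewrite eqr_norm2 (negPf xn) /=.
  by move=> /eqP ->; rewrite opprK.
have Zj : Z j1 j0 != 0.
  apply: contra_neq xn => Z0; move: zj; rewrite Z0 oppr0 => zj.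
  by move: Z0 zj; rewrite eZ !zE pj1 pj0 /= fj1 => -> ->.
(* Up to order, [Bm] and [C] are triangular along the walk, with nonzero
   diagonal; their determinants are the two terms of the cycle minor. *)
pose Bm : 'M[F]_r := \matrix_(i, l) if (i, l) == (j1, j0) then 0 else Z i l.
pose C : 'M[F]_r := \matrix_(i, l) if i == j1 then (l == j0)%:R else Z i l.
(* The determinant is linear in row [j1], which is split into its part off column [j0] and a
   multiple of the unit vector at [j0]. *)
have dZ (W : 'M[F]_r) : (forall i l, (i, l) != (j1, j0) -> W i l = Z i l) ->
    \det W = \det Bm + W j1 j0 * \det C.
  move=> WZ; rewrite -[\det Bm]mul1r; apply: (@determinant_multilinear _ _ _ _ _ j1).
  - apply/rowP => l; rewrite !mxE eqxx xpair_eqE eqxx /=.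
    case: eqVneq => [->|nl]; first by rewrite mulr0 mulr1 add0r.
    by rewrite mul1r mulr0 addr0 WZ // xpair_eqE negb_and nl orbT.
  - apply/matrixP => i l; rewrite !mxE xpair_eqE eq_sym (negPf (neq_lift _ _)) /=.
    by rewrite WZ // xpair_eqE eq_sym (negPf (neq_lift _ _)).
  - apply/matrixP => i l; rewrite !mxE eq_sym (negPf (neq_lift _ _)).
    by rewrite WZ // xpair_eqE eq_sym (negPf (neq_lift _ _)).
have dB : \det Bm != 0.
  apply: ker0_det => v vB.
  have v0 i : ~~ p i -> v i = 0.
    move=> npi; rewrite -(vB i) (bigD1 i) //= big1 ?addr0 => [|l /negPf li];
    rewrite mxE xpair_eqE (_ : i == j1 = false) ?andFb ?Zdelta ?eqxx ?mul1r //;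
      try by apply: contraNF npi => /eqP ->.
    by rewrite eq_sym li mul0r.
  (* For [i] on the walk, row [i] of [Bm] can be nonzero only at [i] and at the column two positions
     further, so the values of [v] vanish one after another from the end of the walk backwards. *)
  suff H d i : p i -> (n - k i <= d)%N -> v i = 0.
    by move=> i; have [pi|/v0//] := boolP (p i); apply: (H (n - k i)%N).
  elim: d i => [|d IH] i pi kd; first by move: (klt i pi) kd; clear; lia.
  have := vB i; rewrite (bigD1 i) //= big1 ?addr0 => [/eqP|l li].
    rewrite mulf_eq0 => /orP[|/eqP//]; rewrite mxE.
    have -> : ((i, i) == (j1, j0)) = false.
      apply/negP => /eqP[e1 e0]; by move: j10; rewrite -e1 -e0 eqxx.
    by rewrite eZ zE implybb fE // (negPf (diag _ _ (klt i pi) (pk i pi))).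
  rewrite mxE; case: ifPn => [_|ne]; first by rewrite mul0r.
  have [->|Z0] := eqVneq (Z i l) 0; first by rewrite mul0r.
  have [pl [li'|kl|[l0 i1]]] := Zedge i l pi Z0; first by rewrite li' eqxx in li.
    by rewrite (IH l) ?mulr0 // kl; move: kd; clear; lia.
  by rewrite l0 i1 eqxx in ne.
have dC : \det C != 0.
  apply: ker0_det => v vC.
  have v0 i : ~~ p i -> v i = 0.
    move=> npi; rewrite -(vC i) (bigD1 i) //= big1 ?addr0 => [|l /negPf li];
    rewrite mxE (_ : i == j1 = false) ?Zdelta ?eqxx ?mul1r //;
      try by apply: contraNF npi => /eqP ->.
    by rewrite eq_sym li mul0r.
  have vj0 : v j0 = 0.
    rewrite -(vC j1) (bigD1 j0) //= big1 ?addr0 => [|l /negPf lj];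
      by rewrite mxE eqxx ?eqxx ?lj ?mul1r ?mul0r.
  (* Each row on the walk other than [j1] links its own column to the one two positions further, so
     the vanishing of [v j0] spreads forwards from the start of the walk. *)
  suff H d i : p i -> (k i <= d)%N -> v i = 0.
    by move=> i; have [pi|/v0//] := boolP (p i); apply: (H (k i)).
  elim: d i => [|d IH] i pi kd.
    by rewrite (kinj i j0) // kj0; move: kd; rewrite leqn0 => /eqP.
  have [ki0|ki0] := eqVneq (k i) 0%N; first by rewrite (kinj i j0) // kj0.
  have ki := klt i pi; have ei := keven i pi.
  have [m km] : exists m, k i = m.+2.
    by move: ki0 ei; case: (k i) => [|[|m]] // _ _; exists m.
  have [i' pi' ki'] : exists2 j, p j & k j = m.
    apply: oex; first by move: ki; rewrite km; clear; lia.
    by move: ei; rewrite km /= negbK.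
  have i'1 : i' == j1 = false.
    by apply/eqP => e; move: kj1 ki; rewrite -e ki' km; clear; lia.
  have := vC i'; rewrite (bigD1 i) //= big1 ?addr0 => [/eqP|l li].
    rewrite mulf_eq0 => /orP[|/eqP//]; rewrite mxE i'1 eZ zE pi pi' /= fE // ki'.
    rewrite (negPf (codiag _ _ _ _)) //; last by rewrite -km pk.
    by move: ki; rewrite km; clear; lia.
  rewrite mxE i'1; have [->|Z0] := eqVneq (Z i' l) 0; first by rewrite mul0r.
  have [pl [->|kl|[_ e]]] := Zedge i' l pi' Z0.
  - by rewrite (IH i') ?mulr0 // ki'; move: kd; rewrite km; clear; lia.
  - by move: li; rewrite (kinj l i) ?eqxx // kl km ki'.
  - by rewrite e eqxx in i'1.
(* With [P = \det Bm] and [Q = Z j1 j0 * \det C] this reads [|P + Q| = |P - Q|], so [P] or [Q] is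
   zero. *)
have := eq_normdet f; rewrite !detz // -eZ (dZ Z (fun _ _ _ => erefl)) (dZ _ zX').
rewrite zj => /eqP; rewrite eqr_norm2 => /orP[] /eqP h.
  have /eqP : Z j1 j0 * \det C = 0 by lra.
  by rewrite mulf_eq0 (negPf Zj) (negPf dC).
have /eqP : \det Bm = 0 by lra.
by rewrite (negPf dB).
Qed.

End CycleSigns.

(** * Forests and coordinates of characters *)

Lemma adjacent_sym (E : finType) (A : {set E * E}) : symmetric (Defs.adjacent A).
Proof. by move=> x y; rewrite /Defs.adjacent orbC. Qed.

(** If the edge is not in the forest, adding it creates a cycle by maximality. This cycle uses the
    new edge, and the rest of it joins the ends inside [A]. *)
Lemma maximal_forest_connect (E : finType) (G A : {set E * E}) (u v : E) :
  maximal_forest G A -> (u, v) \in G -> connect (Defs.adjacent A) u v.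
Proof.
move=> [AG acA maxA] Guv; have [uvA|uvNA] := boolP ((u, v) \in A).
  by apply: connect1; rewrite /Defs.adjacent uvA.
pose A' := ((u, v) |: A)%SET.
have /existsNP[c /not_implyP[c2 /contrapT/andP[cyc uniq_c]]] : ~ acyclic A'.
  move=> acA'; case/negP: uvNA; rewrite -(maxA A') //; first exact: setU11.
    by apply/fintype.subsetP => q /setU1P[->//|]; exact: (fintype.subsetP AG).
  exact: finset.subsetUr.
have A'E x y : Defs.adjacent A' x y ->
    Defs.adjacent A x y \/ (x, y) = (u, v) \/ (x, y) = (v, u).
  rewrite /Defs.adjacent !in_setU1 => /orP[]/orP[/eqP h|h].
  - by right; left.
  - by left; rewrite h.
  - by right; right; case: h => -> ->.
  - by left; rewrite h orbT.
have [allA|] := pselect (forall x, x \in c -> Defs.adjacent A x (next c x)).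
  case: (acA c c2); apply/andP; split=> //.
  by apply: cycle_from_next.
move=> /existsNP[x /not_implyP[xc nAx]].
have := A'E _ _ (next_cycle cyc xc).
(* The cycle is rotated to start with the new edge from [x] to [y]; the path through [q] back to [x]
   is to be shown to lie in [A]. Its steps before the last avoid [x], hence also the new edge. *)
have [i [|y q] rc] := rot_to xc; first by rewrite -(size_rot i) rc in c2.
have -> : next c x = y by rewrite -(next_rot i uniq_c) rc /= eqxx.
move=> [|xyE].
  by rewrite -(next_rot i uniq_c) rc /= eqxx in nAx.
have q2 : (0 < size q)%N by rewrite -(size_rot i) rc in c2.
have /= : cycle (Defs.adjacent A') (x :: y :: q) by rewrite -rc rot_cycle.
move=> /andP[A'xy]; rewrite rcons_path => /andP[pq lq].
have /= : uniq (x :: y :: q) by rewrite -rc rot_uniq.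
rewrite inE negb_or => /andP[/andP[xy xq] /andP[yq uq]].
suff: connect (Defs.adjacent A) y x.
  by case: xyE => -[-> ->] //; rewrite (sym_connect_sym (@adjacent_sym _ _)).
apply/connectP; exists (rcons q x); last by rewrite last_rcons.
rewrite rcons_path; apply/andP; split.
  apply: (@sub_in_path _ (predC1 x) (Defs.adjacent A')) pq.
    move=> a b; rewrite !inE => ax bx /A'E[//|]; case: xyE => -[xu yv].
      by case=> -[au bv]; [case/eqP: ax | case/eqP: bx]; congruence.
    by case=> -[au bv]; [case/eqP: bx | case/eqP: ax]; congruence.
  rewrite /= eq_sym xy /=; apply/allP => a aq; rewrite !inE.
  by apply: contraNneq xq => <-.
(* As the cycle has at least three vertices, its last step into [x] does not start at [y], so it is
   not the new edge run backwards. *)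
have lqy : last y q != y.
  case: q {xq uq pq lq rc} q2 yq => // a q _ yq.
  by apply: contraNneq yq => <- /=; exact: mem_last.
case/A'E: lq => // -[] [lu xv]; case: xyE => -[xu yv]; case/eqP: lqy;
  by rewrite lu yv // -xu xv.
Qed.

(** * Coordinates with respect to a family of independent characters *)

Section Coordinates.
Variables (R : realType) (E : finType) (r : nat) (D : toric_arrangement R E r).

Definition char_mx (f : 'I_r -> E) : 'M[int]_r := \matrix_i arr_char D (f i).

Definition rat_char_mx (f : 'I_r -> E) : 'M[rat]_r := map_mx intr (char_mx f).

Lemma det_rat_char_mx f : \det (rat_char_mx f) = (\det (char_mx f))%:~R.
Proof. exact: det_map_mx. Qed.

Lemma rat_char_mx_unit f : \det (char_mx f) != 0 -> rat_char_mx f \in unitmx.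
Proof. by rewrite unitmxE det_rat_char_mx unitfE intr_eq0. Qed.

Definition coords (g : 'I_r -> E) (e : E) : 'rV[rat]_r :=
  rat_char D e *m invmx (rat_char_mx g).

(** Cramer's rule: minors of the coordinate matrix are quotients of determinants of characters. *)
Lemma det_coords (g f : 'I_r -> E) :
  \det (\matrix_i coords g (f i)) =
  (\det (char_mx f))%:~R / (\det (char_mx g))%:~R.
Proof.
have -> : \matrix_i coords g (f i) =
    rat_char_mx f *m invmx (rat_char_mx g).
  apply/row_matrixP => i; rewrite rowK row_mul; congr (_ *m _).
  by apply/rowP => j; rewrite !mxE.
by rewrite det_mulmx det_inv !det_rat_char_mx.
Qed.

Lemma coords_basis (g : 'I_r -> E) j : \det (char_mx g) != 0 ->
  coords g (g j) = delta_mx 0 j.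
Proof.
move=> dg; have gU := rat_char_mx_unit dg.
rewrite /coords; have -> : rat_char D (g j) = row j (rat_char_mx g).
  by apply/rowP => i; rewrite !mxE.
by rewrite -row_mul mulmxV // row1.
Qed.

Lemma coords_comb (g : 'I_r -> E) (c : 'I_r -> rat) (e : E) j :
  \det (char_mx g) != 0 -> rat_char D e = \sum_i c i *: rat_char D (g i) ->
  coords g e 0 j = c j.
Proof.
move=> dg eE; rewrite /coords eE mulmx_suml summxE (bigD1 j) //= big1 => [|i ij].
  rewrite -scalemxAl -/(coords g _) coords_basis // mxE delta_rV eqxx.
  by rewrite mulr1 addr0.
rewrite -scalemxAl -/(coords g _) coords_basis // mxE delta_rV eq_sym.
by rewrite (negPf ij) mulr0.
Qed.

(** Passing to coordinates is multiplication by an invertible rational matrix, and integers embed in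
    the rationals, so relations are neither created nor lost. *)
Lemma relation_coords (g : 'I_r -> E) (n : E -> int) : \det (char_mx g) != 0 ->
  \sum_e n e *: arr_char D e = 0 <-> \sum_e (n e)%:~R *: coords g e = 0.
Proof.
move=> dg; have gU := rat_char_mx_unit dg.
have -> : \sum_e (n e)%:~R *: coords g e =
    (map_mx intr (\sum_e n e *: arr_char D e) : 'rV[rat]_r) *m
    invmx (rat_char_mx g).
  rewrite map_mx_sum mulmx_suml; apply: eq_bigr => e _.
  by rewrite map_mxZ scalemxAl.
split=> [->|/(congr1 (mulmx^~ (rat_char_mx g)))].
  by rewrite map_mx0 mul0mx.
rewrite mulmxKV // mul0mx => /rowP h; apply/rowP => j; move: (h j).
by rewrite !mxE => /eqP; rewrite intr_eq0 => /eqP.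
Qed.

End Coordinates.

(** * Coordinates in the basis [B] and the effect of the normal form *)

Section Basis.
Variables (R : realType) (E : finType) (B : {set E}).

Definition enum_basis : 'I_#|B| -> E := @enum_val E (mem B).

Lemma enum_basis_inj : injective enum_basis.
Proof. exact: enum_val_inj. Qed.

Lemma enum_basis_in j : enum_basis j \in B.
Proof. exact: enum_valP. Qed.

Lemma enum_basisK e (eB : e \in B) : enum_basis (enum_rank_in eB e) = e.
Proof. exact: enum_rankK_in. Qed.

Lemma codom_enum_basis e : (e \in codom enum_basis) = (e \in B).
Proof.
apply/codomP/idP => [[i ->]|eB]; first exact: enum_basis_in.
by exists (enum_rank_in eB e); rewrite enum_basisK.
Qed.

(** This makes the tori of two arrangements with the same [B] equal in dimension, so that their
    square matrices can be compared. *)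
Lemma char_basis_card r (D : toric_arrangement R E r) : char_basis D B -> r = #|B|.
Proof.
move=> bB; have := size_basis (bB : basis_of fullv [tuple of map _ (enum_tuple B)]).
by rewrite dimvf /dim /= mul1n.
Qed.

Lemma char_basis_det (D : toric_arrangement R E #|B|) :
  char_basis D B -> \det (char_mx D enum_basis) != 0.
Proof.
move=> /basis_free fB; rewrite -(intr_eq0 rat) -det_rat_char_mx -det_tr.
apply: ker0_det => v vB.
have /freeP := fB : free [tuple of map (rat_char D) (enum_tuple B)].
apply; apply/rowP => j; rewrite [RHS]mxE -[RHS](vB j) summxE; apply: eq_bigr => i _.
have d : E := enum_val i.
rewrite !mxE mulrC (nth_map d) ?size_tuple // mxE.
by rewrite -enum_val_nth.
Qed.

Lemma coords_basis_coeffs (D : toric_arrangement R E #|B|) a e j :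
  char_basis D B -> basis_coeffs D B a -> e \notin B ->
  coords D enum_basis e 0 j = a (enum_basis j) e.
Proof.
move=> bB aB eB; apply: (coords_comb (c := fun i => a (enum_basis i) e)).
  exact: char_basis_det.
by rewrite aB // big_enum_val.
Qed.

(** Forest coefficients are positive with equal absolute values, hence they agree. A coefficient
    that differed would be nonzero, so its ends would be joined by a walk in the forest, which
    [agree_walk_differ] excludes. *)
Lemma normal_form_coords (D D' : toric_arrangement R E #|B|) (A : {set E * E}) :
  normal_form D B A -> normal_form D' B A ->
  (forall f, `|\det (char_mx D f)| = `|\det (char_mx D' f)|) ->
  coords D enum_basis = coords D' enum_basis.
Proof.
move=> [bB [a [aB mfA a0]]] [bB' [a' [aB' _ a'0]]] eq_det.
have [dg dg'] := (char_basis_det bB, char_basis_det bB').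
set g := enum_basis in dg dg' *.
have g_inj : injective g := @enum_basis_inj.
have Xg j := coords_basis j dg; have X'g j := coords_basis j dg'.
have eq_dc f : `|\det (\matrix_i coords D g (f i))| =
               `|\det (\matrix_i coords D' g (f i))|.
  by rewrite !det_coords !normrM !normfV -!intr_norm !eq_det.
have eq_norm := eq_norm_entry Xg X'g eq_dc.
apply/funext => e; apply/rowP => j; apply/eqP/negP => /negP nX.
have df : differ g (coords D g) (coords D' g) (g j) e by exists j.
have eB : e \notin B by rewrite -codom_enum_basis (differ_notin Xg X'g df).
have : connect (Defs.adjacent A) (g j) e.
  apply: maximal_forest_connect mfA _; rewrite inE /= enum_basis_in eB /=.
  rewrite -(coords_basis_coeffs j bB aB eB); apply: contra_neq nX => X0.
  by apply/esym/eqP; rewrite X0 -normr_eq0 -eq_norm X0 normr0.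
have ag b c : (b, c) \in A -> agree g (coords D g) (coords D' g) b c.
  move=> bcA; have [AG _ _] := mfA; have := fintype.subsetP AG _ bcA.
  rewrite inE /= => /and3P[bB0 cB abc]; exists (enum_rank_in bB0 b).
  have eb := enum_basisK bB0.
  have := eq_norm c (enum_rank_in bB0 b).
  rewrite !(coords_basis_coeffs _ bB aB cB) !(coords_basis_coeffs _ bB' aB' cB) eb.
  rewrite !gtr0_norm ?a0 ?a'0 // => eqa; split=> //.
  by rewrite codom_enum_basis.
move=> /connectP[p pA ep].
apply: (@agree_walk_differ _ _ _ g _ _ g_inj Xg X'g eq_dc
  (size p) (nth (g j) (g j :: p))).
  move=> i ip; have /(pathP (g j))/(_ i ip) := pA.
  by rewrite /Defs.adjacent => /orP[/ag|/ag]; [left|right].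
by rewrite /= -[nth _ _ _]/(nth (g j) (g j :: p) (size p)) nth_last /= -ep.
Qed.

End Basis.

(** * Monomial equations *)

Section MonomialMaps.
Variable F : fieldType.

Definition nonvanishing n (t : 'rV[F]_n) : Prop := forall j, t 0 j != 0.

(** On nonvanishing vectors this is the homomorphism of tori given by an integer matrix. Matrix
    products become compositions, so unimodular matrices act as automorphisms. *)
Definition monomial_map m n (M : 'M[int]_(m, n)) (t : 'rV[F]_n) : 'rV[F]_m :=
  \row_i \prod_j t 0 j ^ M i j.

Lemma monomial_map_neq0 m n (M : 'M[int]_(m, n)) t :
  nonvanishing t -> nonvanishing (monomial_map M t).
Proof.
move=> t0 i; rewrite mxE; apply/prodf_neq0 => j _; exact: expfz_neq0.
Qed.

Lemma monomial_map1 n (t : 'rV[F]_n) : monomial_map 1%:M t = t.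
Proof.
apply/rowP => i; rewrite mxE (bigD1 i) //= big1 => [|j ji].
  by rewrite mxE eqxx mulr1 expr1z.
by rewrite mxE eq_sym (negPf ji) expr0z.
Qed.

Lemma monomial_mapM m n p (M : 'M[int]_(m, n)) (N : 'M[int]_(n, p)) t :
  nonvanishing t -> monomial_map (M *m N) t = monomial_map M (monomial_map N t).
Proof.
move=> t0; apply/rowP => i; rewrite !mxE.
under [in RHS]eq_bigr => k _.
  rewrite mxE (big_morph (fun x => x ^ M i k)
    (fun x y => expfzMl x y (M i k)) (exp1rz _ (M i k))).
  over.
rewrite exchange_big /=; apply: eq_bigr => j _.
rewrite mxE (big_morph (fun d => t 0 j ^ d)
  (fun c d => expfzDr c d (t0 j)) (expr0z _)).
by apply: eq_bigr => k _; rewrite exprz_exp mulrC.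
Qed.

Lemma monomial_mapK n (M : 'M[int]_n) t : M \in unitmx -> nonvanishing t ->
  monomial_map (invmx M) (monomial_map M t) = t.
Proof. by move=> uM t0; rewrite -monomial_mapM // mulVmx // monomial_map1. Qed.

Lemma monomial_mapVK n (M : 'M[int]_n) t : M \in unitmx -> nonvanishing t ->
  monomial_map M (monomial_map (invmx M) t) = t.
Proof. by move=> uM t0; rewrite -monomial_mapM // mulmxV // monomial_map1. Qed.

End MonomialMaps.

(** * The number of solutions of a square monomial system *)

Section CountingSolutions.
Variable F : numClosedFieldType.

Lemma nth_roots (n : nat) (c : F) : (0 < n)%N -> c != 0 ->
  exists s : seq F, [/\ uniq s, size s = n & forall x, (x \in s) = (x ^+ n == c)].
Proof.
move=> n0 c0; pose p : {poly F} := 'X^n - c%:P.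
have sp : size p = n.+1 by rewrite size_XnsubC.
have lp : lead_coef p = 1 by exact: lead_coefXnsubC.
have [s ps] := closed_field_poly_normal p.
rewrite lp scale1r in ps.
exists s; split.
- rewrite -separable_prod_XsubC -ps separable_poly.unlock; apply/Bezout_coprimepP.
  (* Separability by a Bezout identity: [n * p - X * p'] is the constant [- n * c], nonzero in
     characteristic 0. *)
  exists (n%:R, - 'X) => /=.
  rewrite (_ : _ + _ = (- (n%:R * c))%:P).
    by rewrite polyC_eqp1 oppr_eq0 mulf_neq0 // pnatr_eq0 -lt0n.
  rewrite /p derivB derivC subr0 derivXn mulNr mulrnAr -exprS prednK //.
  by rewrite polyCN polyCM polyC_natr mulrBr !mulr_natl addrAC subrr add0r.
- by move: sp; rewrite ps size_prod_XsubC => -[].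
- move=> x; rewrite -root_prod_XsubC -ps rootE.
  by rewrite !hornerE subr_eq0.
Qed.

Lemma int_roots (d : int) (c : F) : d != 0 -> c != 0 ->
  exists s : seq F, [/\ uniq s, size s = `|d|%N &
    forall x, (x \in s) = (x != 0) && (x ^ d == c)].
Proof.
move=> d0 c0.
have pos (n : nat) (b : F) : (0 < n)%N -> b != 0 -> exists s : seq F,
    [/\ uniq s, size s = n & forall x, (x \in s) = (x != 0) && (x ^+ n == b)].
  move=> n0 b0; have [s [us ss sP]] := nth_roots n0 b0.
  exists s; split=> // x; rewrite sP; case: (eqVneq x 0) => [->|//] /=.
  by rewrite expr0n gtn_eqF // eq_sym (negPf b0).
case: d d0 => n d0; first by have := pos n c; rewrite lt0n; apply.
(* A negative exponent [- n.+1] is made positive by inverting [c]. *)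
have [//||s [us ss sP]] := pos n.+1 c^-1; first by rewrite invr_eq0.
exists s; split=> // x; rewrite sP /exprz /=.
by congr (_ && _); rewrite -(inj_eq invr_inj) invrK.
Qed.

Lemma diag_solutions n (d : 'I_n -> int) (c : 'rV[F]_n) :
  (forall i, d i != 0) -> nonvanishing c ->
  exists s : seq 'rV[F]_n, [/\ uniq s, size s = (\prod_i `|d i|)%N &
    forall t : 'rV[F]_n, (t \in s) <->
      nonvanishing t /\ forall i, t 0 i ^ d i = c 0 i].
Proof.
move=> d0 c0; have /choice[S SP] i := int_roots (d0 i) (c0 i).
pose h (f : {dffun forall i, 'I_(size (S i))}) : 'rV[F]_n := \row_i (S i)`_(f i).
exists (codom h); split.
- rewrite map_inj_uniq ?enum_uniq // => f g /rowP fg; apply/ffunP => i.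
  have [uS _ _] := SP i; apply/val_inj/eqP.
  by have /eqP := fg i; rewrite !mxE nth_uniq.
- rewrite size_codom card_dep_ffun foldrE big_map big_enum /=.
  by apply: eq_bigr => i _; rewrite card_ord; have [_ ->] := SP i.
move=> t; split=> [/codomP[f ->]|[t0 td]].
  have H i : ((S i)`_(f i) != 0) && ((S i)`_(f i) ^ d i == c 0 i).
    by have [_ _ <-] := SP i; exact: mem_nth.
  by split=> i; rewrite mxE; have /andP[? /eqP] := H i.
have tS (i : 'I_n) : (index (t 0%R i) (S i) < size (S i))%N.
  by rewrite index_mem; have [_ _ ->] := SP i; rewrite t0 td eqxx.
apply/codomP; exists (finfun (fun i => Ordinal (tS i))).
by apply/rowP => i; rewrite mxE ffunE /= nth_index // -index_mem.
Qed.

(** The Smith normal form [L *m Dg *m P] reduces the system to independent equations: [L] and [P]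
    are changes of coordinates on the tori, and the product of the diagonal entries is the
    determinant up to sign. *)
Lemma monomial_solutions n (M : 'M[int]_n) (c : 'rV[F]_n) :
  \det M != 0 -> nonvanishing c ->
  exists s : seq 'rV[F]_n, [/\ uniq s, size s = `|\det M|%N &
    forall t : 'rV[F]_n, (t \in s) <-> nonvanishing t /\ monomial_map M t = c].
Proof.
move=> M0 c0; have [L uL [P uP [d _ eM]]] := int_Smith_normal_form M.
set Dg := \matrix_(i, j) _ in eM.
have Dgd : Dg = diag_mx (\row_i d`_i).
  by apply/matrixP => i j; rewrite !mxE.
have unit_det (N : 'M[int]_n) : N \in unitmx -> `|\det N|%N = 1%N.
  by rewrite unitmxE => /orP[] /eqP ->.
have detM : `|\det M|%N = (\prod_(i < n) `|(d`_i)%R|)%N.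
  rewrite eM !det_mulmx !abszM (unit_det _ uL) (unit_det _ uP) mul1n muln1.
  rewrite Dgd det_diag.
  rewrite (big_morph absz abszM (erefl _)).
  by apply: eq_bigr => i _; rewrite mxE.
have d0 (i : 'I_n) : d`_i != 0.
  move: M0; rewrite -absz_eq0 detM; apply: contraNneq => di.
  by apply/eqP; rewrite (bigD1 i) //= di mul0n.
have Lc0 := monomial_map_neq0 (invmx L) c0.
have [s [us ss sP]] := diag_solutions d0 Lc0.
have s0 t : t \in s -> nonvanishing t by move/sP => [].
exists (map (monomial_map (invmx P)) s); split.
- rewrite map_inj_in_uniq // => t u /s0 t0 /s0 u0 /(congr1 (monomial_map P)).
  by rewrite !monomial_mapVK.
- by rewrite size_map ss detM.
have DgE (t : 'rV[F]_n) i : monomial_map Dg t 0 i = t 0 i ^ d`_i.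
  rewrite mxE (bigD1 i) //= big1 => [|j ji].
    by rewrite mxE eqxx mulr1n mulr1.
  by rewrite mxE eq_sym val_eqE (negPf ji) mulr0n expr0z.
move=> t; split=> [/mapP[u us' ->]|[t0 Mt]].
  have [u0 ud] := (sP u).1 us'; split; first exact: monomial_map_neq0.
  rewrite eM -mulmxA monomial_mapM; last exact: monomial_map_neq0.
  rewrite monomial_mapM; last exact: monomial_map_neq0.
  rewrite monomial_mapVK // -[RHS](monomial_mapVK uL c0); congr monomial_map.
  by apply/rowP => i; rewrite DgE ud.
apply/mapP; exists (monomial_map P t); last by rewrite monomial_mapK.
apply/sP; split=> [|i]; first exact: monomial_map_neq0.
rewrite -DgE -Mt eM -mulmxA monomial_mapM // monomial_mapK ?monomial_mapM //.
exact/monomial_map_neq0/monomial_map_neq0.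
Qed.

End CountingSolutions.

(** * Connected subsets of the torus *)

Local Open Scope classical_set_scope.

Lemma continuous_real_complex (R : realType) :
  continuous (fun s : R => s%:C%C : CC R).
Proof.
move=> x; apply/cvgrPdist_lt => eps eps0; have : (0 : R[i]) < eps := eps0.
rewrite ltcE => /andP[/eqP im0 re0].
apply: filterS (@nbhsx_ballx R R^o x _ re0) => s; rewrite -ball_normE /= => xs.
rewrite -(@rmorphB _ _ (real_complex R)) (normc_def _) /= expr0n addr0 sqrtr_sqr.
by rewrite (@ltcE R) /= im0 eqxx.
Qed.

Lemma cvg_exprz (K : numFieldType) (T : Type) (F : set_system T) (FF : Filter F)
  (f : T -> K) (a : K) (n : int) : a != 0 -> f @ F --> a ->
  (fun x => f x ^ n) @ F --> a ^ n.
Proof.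
move=> a0 fa; have pos (m : nat) : (fun x => f x ^+ m) @ F --> a ^+ m.
  elim: m => [|m IH]; first exact: cvg_cst.
  rewrite exprS; under eq_fun do rewrite exprS; exact: cvgM.
case: n => n; first exact: pos.
by apply: cvgV; [exact: expf_neq0 | exact: pos].
Qed.

Lemma cvg_row (T : Type) (F : set_system T) (FF : Filter F) (K : topologicalType)
  (n : nat) (f : T -> 'rV[K]_n) (a : 'rV[K]_n) :
  (forall j, (fun x => f x 0 j) @ F --> a 0 j) -> f @ F --> a.
Proof.
move=> fa A [P aP PA]; rewrite nbhs_filterE.
have : \forall x \near F, forall j, P 0 j (f x 0 j).
  by apply: filter_forall => j; apply: fa; exact: aP.
by apply: filterS => x Px; apply: PA => i j; rewrite (ord1 i).
Qed.

Section Torus.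
Variable R : realType.
Implicit Types r : nat.

(** The pairing of characters with one-parameter subgroups: on the subgroup with exponents [v], the
    character [m] is the power of the parameter by this integer. *)
Definition char_pairing r (m v : 'rV[int]_r) : int := \sum_j m 0 j * v 0 j.

Definition translate r (t : 'rV[CC R]_r) (v : 'rV[int]_r) (z : CC R) :
  'rV[CC R]_r := \row_j (t 0 j * z ^ v 0 j).

Lemma torus_translate r (t : 'rV[CC R]_r) v z :
  torus t -> z != 0 -> torus (translate t v z).
Proof. by move=> t0 z0 j; rewrite mxE mulf_neq0 // expfz_neq0. Qed.

Lemma eval_char_neq0 r (m : 'rV[int]_r) (t : 'rV[CC R]_r) :
  torus t -> eval_char m t != 0.
Proof. by move=> t0; apply/prodf_neq0 => j _; exact: expfz_neq0. Qed.

Lemma eval_char_translate r (m v : 'rV[int]_r) (t : 'rV[CC R]_r) z : z != 0 ->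
  eval_char m (translate t v z) = eval_char m t * z ^ char_pairing m v.
Proof.
move=> z0; rewrite /char_pairing (big_morph (fun d => z ^ d)
  (fun c d => expfzDr c d z0) (expr0z _)) -big_split /=.
by apply: eq_bigr => j _; rewrite mxE expfzMl exprz_exp [v 0 j * _]mulrC.
Qed.

Definition segment_to (z : CC R) (s : R) : CC R := 1 + s%:C%C * (z - 1).

(** The real part is positive along the segment before its end [z], and [z] is nonzero. *)
Lemma segment_to_neq0 (z : CC R) s : z != 0 -> 0 <= complex.Re z ->
  0 <= s <= 1 -> segment_to z s != 0.
Proof.
move=> z0 Rez /andP[s0 s1]; apply/eqP => e.
have re0 : 1 + s * (complex.Re z - 1) = 0.
  have := congr1 (@complex.Re R) e; rewrite /segment_to; case: (z) => a b /= <-.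
  by rewrite mul0r subr0.
have s1' : s = 1.
  by apply/le_anti; rewrite s1 /= -subr_ge0; nra.
by move: e; rewrite /segment_to s1' mul1r addrCA subrr addr0; exact/eqP.
Qed.

Lemma translate_connected r (t : 'rV[CC R]_r) v (z : CC R) :
  z != 0 -> 0 <= complex.Re z ->
  connected ((fun s => translate t v (segment_to z s)) @` `[0, 1]).
Proof.
move=> z0 Rez; apply: connected_continuous_connected.
  exact: segment_connected.
apply: continuous_in_subspaceT => s; rewrite inE /= in_itv /= => s01.
apply: cvg_row => j; rewrite mxE; under eq_fun do rewrite mxE.
apply: cvgM; first exact: cvg_cst.
apply: cvg_exprz; first exact: segment_to_neq0.
apply: cvgD; first exact: cvg_cst.
by apply: cvgM; [exact: continuous_real_complex | exact: cvg_cst].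
Qed.

(** As the exponent is even, [z] and [- z] are both roots, and one of them has nonnegative real
    part. *)
Lemma exp_even_root (d : int) (c : CC R) : d != 0 -> c != 0 ->
  exists z : CC R, [/\ z != 0, 0 <= complex.Re z & z ^ (2 * d) = c].
Proof.
move=> d0 c0; have d20 : 2 * d != 0 :> int by rewrite mulf_neq0.
have [s [_ ss sP]] := @int_roots R[i] (2 * d) c d20 c0.
have [z zs] : exists z, z \in s.
  move: ss; case: (s) => [|z s'] /=; last by exists z; exact: mem_head.
  by move/esym/eqP; rewrite absz_eq0 (negPf d20).
move: zs; rewrite sP => /andP[z0 /eqP zc].
have [Rez|Rez] := leP 0 (complex.Re z); first by exists z.
exists (- z); split; first by rewrite oppr_eq0.
  by case: (z) Rez => a b /= /ltW; rewrite oppr_ge0.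
by rewrite -zc -exprz_exp -[in RHS]exprz_exp -[(- z) ^ 2]/((- z) ^+ 2) sqrrN.
Qed.

(* Doubling [v] lets the translating factor be chosen off the negative reals, so
   that a straight segment joins it to 1 inside C^*. *)
Lemma translate_char r (t : 'rV[CC R]_r) (m v : 'rV[int]_r) (c : CC R) :
  torus t -> char_pairing m v != 0 -> c != 0 ->
  exists t' : 'rV[CC R]_r, exists C : set 'rV[CC R]_r,
    [/\ connected C, C t, C t', eval_char m t' = c
      & forall u, C u -> torus u /\
          forall m', char_pairing m' v = 0 -> eval_char m' u = eval_char m' t].
Proof.
move=> t0 mv c0; have mt0 := eval_char_neq0 m t0.
have [|z [z0 Rez zc]] := exp_even_root mv (c := c / eval_char m t).
  by rewrite mulf_neq0 // invr_eq0.
have pair2 m' : char_pairing m' (2 *: v) = 2 * char_pairing m' v.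
  by rewrite /char_pairing mulr_sumr; apply: eq_bigr => j _; rewrite mxE mulrCA.
exists (translate t (2 *: v) z).
exists ((fun s => translate t (2 *: v) (segment_to z s)) @` `[0, 1]); split.
- exact: translate_connected.
- exists 0; first by rewrite /= in_itv /= lexx ler01.
  by apply/rowP => j; rewrite mxE /segment_to mul0r addr0 exp1rz mulr1.
- exists 1; first by rewrite /= in_itv /= lexx ler01.
  by rewrite /segment_to mul1r addrC subrK.
- by rewrite eval_char_translate // pair2 zc mulrC divfK.
- move=> u [s /= /[!in_itv]/= s01 <-]; have sz := segment_to_neq0 z0 Rez s01.
  split=> [|m' m'v]; first exact: torus_translate.
  by rewrite eval_char_translate // pair2 m'v mulr0 expr0z mulr1.
Qed.

End Torus.

(** * Layers *)

Section Layers.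
Variables (R : realType) (E : finType) (r : nat).
Implicit Types (D : toric_arrangement R E r) (f : 'I_r -> E).

Lemma hypertori_cap1 D e : hypertori_cap D [set e]%SET = hypertorus D e.
Proof.
apply/seteqP; split=> t /=; first by move=> [_]; apply; rewrite /= inE.
by move=> te; split=> [|e' /=]; [case: te | rewrite inE => /eqP ->].
Qed.

Lemma component_layer D (A : {set E}) t : hypertori_cap D A t ->
  exists2 W : layer D,
    proj1_sig W = connected_component (hypertori_cap D A) t & proj1_sig W t.
Proof.
move=> At; have H : is_layer D (connected_component (hypertori_cap D A) t).
  by exists A; exists t.
by exists (exist _ _ H) => //=; exact: connected_component_refl.
Qed.

Lemma layer_connected D (W : layer D) : connected (proj1_sig W).
Proof.
by have [A [t _ <-]] := proj2_sig W; exact: component_connected.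
Qed.

Lemma layer_nonempty D (W : layer D) : proj1_sig W !=set0.
Proof.
by have [A [t At <-]] := proj2_sig W; exists t; exact: connected_component_refl.
Qed.

Lemma layer_inj D (V W : layer D) : proj1_sig V = proj1_sig W -> V = W.
Proof.
case: V W => [V HV] [W HW] /= VW; subst W.
by rewrite (Prop_irrelevance HV HW).
Qed.

(** Containment in a hypertorus is expressed by data that an isomorphism over [E] preserves: a layer
    is connected, so it lies in a single component of the hypertorus. *)
Lemma layer_sub_hypertorus D (W : layer D) e :
  proj1_sig W `<=` hypertorus D e <->
  exists2 V, hypertorus_layers e V & layer_le V W.
Proof.
split=> [We|[V [t et VE] VW] u /VW]; last first.
  by rewrite -VE; exact: connected_component_sub.
have [t Wt] := layer_nonempty W; have et := We t Wt.
have [|V VE Vt] := @component_layer D [set e]%SET t; first by rewrite hypertori_cap1.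
rewrite hypertori_cap1 in VE; exists V; first by exists t.
rewrite /layer_le VE; apply: connected_component_max => //.
exact: layer_connected.
Qed.

Definition layer_inside D f (W : layer D) : Prop :=
  forall i, proj1_sig W `<=` hypertorus D (f i).

Definition image_cap D f := hypertori_cap D [set f i | i in 'I_r]%SET.

Lemma image_capP D f t : image_cap D f t <-> forall i, hypertorus D (f i) t.
Proof.
split=> [[_ H] i|H]; first by apply: H; rewrite /= imset_f.
split=> [i|e /= /imsetP[i _ ->]//]; by have [+ _] := H i; apply.
Qed.

Lemma image_cap_monomial D f t : image_cap D f t <->
  nonvanishing t /\
  monomial_map (char_mx D f) t = \row_i (arr_const D (f i))^-1.
Proof.
rewrite image_capP; split=> [H|[t0 /rowP H] i].
  split=> [i|]; first by have [+ _] := H i; apply.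
  apply/rowP => i; rewrite !mxE; have [_ Hi] := H i.
  have c0 := arr_const_neq0 D (f i).
  apply: (mulfI c0); rewrite mulfV // -[RHS]Hi; congr (_ * _).
  by apply: eq_bigr => j _; rewrite mxE.
split=> //; have := H i; rewrite !mxE => Hi.
rewrite /eval_char (eq_bigr (fun j => t 0 j ^ char_mx D f i j)) => [|j _];
  last by rewrite mxE.
by rewrite Hi mulfV // arr_const_neq0.
Qed.

Lemma image_cap_points D f : \det (char_mx D f) != 0 ->
  exists s : seq 'rV[CC R]_r, [/\ uniq s, size s = `|\det (char_mx D f)|%N &
    forall t : 'rV[CC R]_r, (t \in s) <-> image_cap D f t].
Proof.
move=> d0; have [|s [us ss sP]] := @monomial_solutions R[i] r (char_mx D f)
    (\row_i (arr_const D (f i))^-1) d0.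
  by move=> i; rewrite mxE invr_eq0 arr_const_neq0.
by exists s; split=> // t; rewrite image_cap_monomial; exact: sP.
Qed.

(** In a Hausdorff space finite sets are closed, so [[set t]] is both open and closed in [C]. *)
Lemma finite_connected (s : seq 'rV[CC R]_r) (C : set 'rV[CC R]_r) t :
  connected C -> (forall u, C u -> u \in s) -> C t -> C = [set t].
Proof.
move=> cC Cs Ct; have haus := @norm_hausdorff _ 'rV[CC R]_r.
have fin (A : set 'rV[CC R]_r) : A `<=` C -> closed A.
  have [closed_fin _] := @accessible_finite_set_closed 'rV[CC R]_r.
  move=> AC; apply: closed_fin; first exact: hausdorff_accessible.
  by apply: (@sub_finite_set _ _ [set` s]); [move=> u /AC/Cs | exact: finite_seq].
apply/esym/cC; first by exists t.
- exists (~` (C `\ t)); first by apply: closed_openC; apply: fin => u [].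
  apply/seteqP; split=> [u -> /=|u [Cu nu]]; first by split=> // -[_]; apply.
  by apply: contrapT => ut; apply: nu.
- exists [set t]; first by apply: fin => u ->.
  by apply/seteqP; split=> [u -> /=|u []].
Qed.

(** The intersection is finite, so each layer inside it is a single point, and the determinant
    counts these layers. *)
Lemma points_layers D f : \det (char_mx D f) != 0 ->
  exists s : seq 'rV[CC R]_r, [/\ uniq s, size s = `|\det (char_mx D f)|%N,
    forall t : 'rV[CC R]_r, t \in s ->
      exists2 W : layer D, layer_inside f W & proj1_sig W = [set t] &
    forall W : layer D, layer_inside f W ->
      exists2 t : 'rV[CC R]_r, t \in s & proj1_sig W = [set t]].
Proof.
move=> d0; have [s [us ss sP]] := image_cap_points d0; exists s; split=> //.
  move=> t /sP ft; have [W WE Wt] := component_layer ft.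
  have Wf : proj1_sig W `<=` image_cap D f.
    by rewrite WE; exact: connected_component_sub.
  exists W; first by move=> i u /Wf/image_capP.
  apply: (finite_connected (s := s)) => //; first exact: layer_connected.
  by move=> u /Wf/sP.
move=> W Wf; have [t Wt] := layer_nonempty W.
have Ws u : proj1_sig W u -> u \in s.
  by move=> Wu; apply/sP/image_capP => i; exact: Wf.
exists t; first exact: Ws.
exact: (finite_connected (@layer_connected D W) Ws Wt).
Qed.

(** A vector pairing to zero with all characters would pair to zero with their rational span, hence
    with every unit vector. *)
Lemma essential_pairing D (v : 'rV[int]_r) : essential D -> v != 0 ->
  exists e, char_pairing (arr_char D e) v != 0.
Proof.
move=> essD v0; apply: contrapT => /forallNP Hv.
pose w : 'cV[rat]_r := map_mx intr v^T.
pose h := linfun (mulmxr w : 'rV[rat]_r -> 'rV[rat]_1).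
have full : (fullv <= lker h)%VS.
  rewrite -essD; apply/span_subvP => _ /mapP[e _ ->].
  rewrite memv_ker lfunE /=; apply/eqP/rowP => k; rewrite (ord1 k) !mxE.
  have /negP/negPn/eqP ev := Hv e.
  transitivity ((char_pairing (arr_char D e) v)%:~R : rat); last by rewrite ev.
  rewrite /char_pairing rmorph_sum /=.
  by apply: eq_bigr => j _; rewrite !mxE rmorphM.
case/negP: v0; apply/eqP/rowP => j; rewrite mxE.
have /subvP/(_ (delta_mx 0 j) (memvf _)) := full.
rewrite memv_ker lfunE /= -rowE => /eqP/rowP/(_ 0); rewrite !mxE => /eqP.
by rewrite intr_eq0 => /eqP.
Qed.

(** A kernel vector [v] gives a one-parameter subgroup on which all characters of [f] are trivial,
    while essentiality provides some [e] whose character is not. The component [V] then meets the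
    hypertorus of [e] without lying in it. *)
Lemma strict_sublayer D f (W0 : layer D) : essential D ->
  \det (char_mx D f) = 0 -> layer_inside f W0 ->
  exists V W : layer D,
    [/\ layer_inside f V, layer_inside f W, layer_le V W & V <> W].
Proof.
move=> essD /eqP; rewrite -det_tr => /det0P[v v0 vM] W0f.
have [t W0t] := layer_nonempty W0.
have ft : image_cap D f t by apply/image_capP => i; exact: W0f.
have t0 : torus t by case: ft.
have [e ve] := essential_pairing essD v0.
have [V VE Vt] := component_layer ft.
have Vf : proj1_sig V `<=` image_cap D f.
  by rewrite VE; exact: connected_component_sub.
have fv i : char_pairing (arr_char D (f i)) v = 0.
  move/rowP/(_ i): vM; rewrite !mxE => <-; apply: eq_bigr => j _.
  by rewrite !mxE mulrC.
(* Translating [t] along the subgroup stays in [V] and gives the character of [e] any nonzero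
   value. *)
have reach (c : CC R) : c != 0 ->
    exists2 u, proj1_sig V u & eval_char (arr_char D e) u = c.
  move=> /(translate_char t0 ve)[u [C [cC Ct Cu uc CP]]]; exists u => //.
  rewrite VE; apply: (connected_component_max Ct _ cC Cu) => x Cx.
  have [x0 xP] := CP x Cx; apply/image_capP => i; split=> //.
  by rewrite (xP _ (fv i)); have [_] := (image_capP D f t).1 ft i.
have c0 := arr_const_neq0 D e.
(* [u] is chosen on the hypertorus of [e], and [u'] off it: there the constant times the character
   is 2 instead of 1. *)
have [u Vu ue] := reach (arr_const D e)^-1 ltac:(by rewrite invr_eq0).
have [u' Vu' ue'] := reach (2 / arr_const D e)
  ltac:(by rewrite mulf_neq0 ?invr_eq0 ?pnatr_eq0).
pose A := (e |: [set f i | i in 'I_r])%SET.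
have Au : hypertori_cap D A u.
  have [u0 uf] := Vf u Vu; split=> // e' /=; rewrite !inE => /orP[/eqP ->|/uf//].
  by split=> //; rewrite ue mulfV.
have [W WE Wu] := component_layer Au.
have WA : proj1_sig W `<=` hypertori_cap D A.
  by rewrite WE; exact: connected_component_sub.
have Wcap : proj1_sig W `<=` image_cap D f.
  move=> x /WA[x0 xA]; split=> // e' e'f; apply: xA.
  by apply/setU1P; right; exact: e'f.
exists V, W; split.
- by move=> i x /Vf/image_capP.
- by move=> i x /Wcap/image_capP.
- rewrite /layer_le VE; have := connected_component_max Wu Wcap (@layer_connected D W).
  rewrite (@same_connected_component _ _ t u) // /image_cap -VE //.
- move=> VW; have := WA u'; rewrite -VW => /(_ Vu')[_ /(_ e)].
  rewrite /= setU11 => /(_ isT)[_]; rewrite ue' mulrC divfK // => /eqP.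
  by rewrite (eqr_nat _ 2 1).
Qed.

End Layers.

(** * Determinants compared along maps between posets of layers *)

Section LayerMaps.
Variables (R : realType) (E : finType) (r : nat) (D D' : toric_arrangement R E r).
Variable phi : layer D -> layer D'.
Hypothesis phi_inj : injective phi.
Hypothesis phi_le : forall V W, layer_le V W -> layer_le (phi V) (phi W).
Hypothesis phi_hyp : forall e V,
  hypertorus_layers e V -> hypertorus_layers e (phi V).

Lemma layer_inside_map f (W : layer D) : layer_inside f W -> layer_inside f (phi W).
Proof.
move=> Wf i; apply/layer_sub_hypertorus.
have /layer_sub_hypertorus[V VP VW] := Wf i.
by exists (phi V); [exact: phi_hyp | exact: phi_le].
Qed.

(** Two distinct comparable layers inside the hypertori of [f] would be sent to comparable points,
    which coincide, against injectivity. *)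
Lemma layer_map_det0 f : essential D ->
  \det (char_mx D f) = 0 -> \det (char_mx D' f) != 0 ->
  forall W : layer D, ~ layer_inside f W.
Proof.
move=> essD d0 /points_layers[s [_ _ _ sP]] W0 W0f.
have [V [W [Vf Wf VW]]] := strict_sublayer essD d0 W0f; apply; apply: phi_inj.
have [t _ tV] := sP _ (layer_inside_map Vf).
have [u _ uW] := sP _ (layer_inside_map Wf).
apply: layer_inj; rewrite tV uW; have := phi_le VW.
by rewrite /layer_le tV uW => /(_ u erefl) /= ->.
Qed.

(** The determinants count the point layers inside the hypertori of [f], and [phi] maps these
    injectively. *)
Lemma layer_map_det_le f :
  \det (char_mx D f) != 0 -> \det (char_mx D' f) != 0 ->
  (`|\det (char_mx D f)| <= `|\det (char_mx D' f)|)%N.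
Proof.
move=> /points_layers[s [us <- sW _]] /points_layers[s' [_ <- _ Ws']].
have /choice[h hP] t : exists t', t \in s -> t' \in s' /\
    exists2 W, proj1_sig W = [set t] & proj1_sig (phi W) = [set t'].
  have [ts|/negP nts] := boolP (t \in s); last by exists t.
  have [W Wf WE] := sW t ts; have [t' ts' WE'] := Ws' _ (layer_inside_map Wf).
  by exists t' => _; split=> //; exists W.
rewrite -(size_map h); apply: uniq_leq_size.
  rewrite map_inj_in_uniq // => t u /hP[_ [V Vt Vh]] /hP[_ [W Wu Wh]] tu.
  have VW : V = W by apply/phi_inj/layer_inj; rewrite Vh Wh tu.
  have : [set u] t by rewrite -Wu -VW Vt.
  by [].
by move=> _ /mapP[t /hP[ts' _] ->].
Qed.

End LayerMaps.

(** A nonzero determinant provides a layer inside the hypertori of [f], which transports to the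
    other side, so the two determinants vanish together. Otherwise the isomorphism and its inverse
    give the two inequalities. *)
Lemma same_layer_poset_det (R : realType) (E : finType) (r : nat)
  (D D' : toric_arrangement R E r) (f : 'I_r -> E) :
  essential D -> essential D' -> same_layer_poset D D' ->
  `|\det (char_mx D f)| = `|\det (char_mx D' f)|.
Proof.
move=> essD essD' [phi [[psi phiK psiK] phi_le phi_hyp]].
have phi_le1 V W : layer_le V W -> layer_le (phi V) (phi W) by move/phi_le.
have psi_le V W : layer_le V W -> layer_le (psi V) (psi W).
  by move=> VW; apply/phi_le; rewrite !psiK.
have phi_hyp1 e V : hypertorus_layers e V -> hypertorus_layers e (phi V).
  by move=> Ve; rewrite -phi_hyp; exists V.
have psi_hyp e V : hypertorus_layers e V -> hypertorus_layers e (psi V).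
  by rewrite -phi_hyp => -[W We <-]; rewrite phiK.
have [phi_inj psi_inj] := (can_inj phiK, can_inj psiK).
have nonempty (D1 : toric_arrangement R E r) : \det (char_mx D1 f) != 0 ->
    exists W : layer D1, layer_inside f W.
  move=> d0; have [[|t s] [_ ss sP _]] := points_layers d0.
    by move/esym/eqP: ss; rewrite absz_eq0 (negPf d0).
  by have [W Wf _] := sP t (mem_head _ _); exists W.
have [d0|d0] := eqVneq (\det (char_mx D f)) 0.
  have [->|d0'] := eqVneq (\det (char_mx D' f)) 0; first by rewrite d0.
  have [W Wf] := nonempty _ d0'.
  case: (layer_map_det0 phi_inj phi_le1 phi_hyp1 essD d0 d0' (W := psi W)).
  exact: (layer_inside_map psi_le psi_hyp).
have [d0'|d0'] := eqVneq (\det (char_mx D' f)) 0.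
  have [W Wf] := nonempty _ d0.
  case: (layer_map_det0 psi_inj psi_le psi_hyp essD' d0' d0 (W := phi W)).
  exact: (layer_inside_map phi_le1 phi_hyp1).
rewrite -!abszE; congr Posz; apply/eqP; rewrite eqn_leq.
by rewrite (layer_map_det_le phi_inj) // (layer_map_det_le psi_inj).
Qed.

Theorem theorem3p13 (R : realType) (E : finType) (r r' : nat)
    (D : toric_arrangement R E r) (D' : toric_arrangement R E r')
    (B : {set E}) (A : {set E * E}) :
  essential D -> essential D' ->
  same_layer_poset D D' ->
  normal_form D B A -> normal_form D' B A ->
  forall n : E -> int,
    \sum_(e : E) n e *: arr_char D e = 0 <->
    \sum_(e : E) n e *: arr_char D' e = 0.
Proof.
move=> essD essD' same nfD nfD' n.
have [bD _] := nfD; have [bD' _] := nfD'.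
have rB := char_basis_card bD; have rB' := char_basis_card bD'; subst r r'.
rewrite (relation_coords _ (char_basis_det bD)).
rewrite (relation_coords _ (char_basis_det bD')).
rewrite (normal_form_coords nfD nfD') // => f.
exact: same_layer_poset_det.
Qed.
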